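(* For any integer $m>1$, there are infinitely many integers $k$ satisfying $k\not\equiv -1 \pmod{q}$ for every prime number $q\mid (m-1)$, such that for every positive integer $n$, $k m^n+1$ is a composite number.
   Context: A composite number is an integer greater than $1$ that is not prime. When $m=2$ there is no prime $q\mid (m-1)$, so the congruence condition is vacuous. *)

(* Defs.v *)
From mathcomp Require Import all_boot all_order all_algebra.

Set Implicit Arguments.
Unset Strict Implicit.
Unset Printing Implicit Defensive.

Import Order.TTheory GRing.Theory Num.Theory.

Local Open Scope ring_scope.

Definition composite (z : int) : bool := (1 < z) && ~~ prime `|z|%N.

(* Main.v *)
Require Import Defs.
From mathcomp Require Import all_boot all_order all_algebra.
From mathcomp Require Import cyclic cyclotomic algC.
From mathcomp Require Import ring zify.
From mathcomp Require Import classical_sets cardinality.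

Set Implicit Arguments.
Unset Strict Implicit.
Unset Printing Implicit Defensive.

Import Order.TTheory GRing.Theory Num.Theory.

Local Open Scope nat_scope.

(** A number k is forced to make every k m^n + 1 composite by a covering system
    of congruences. If n = a modulo d whenever a class (d, a) of the system
    contains n, if p is a prime with m^d = 1 modulo p, and if k m^a = -1
    modulo p, then p divides k m^n + 1 for every n in the class. Taking one
    prime per class, distinct primes for distinct classes, the Chinese remainder
    theorem imposes all the conditions on k at once ([covering_sieve]). The
    primes are chosen coprime to m - 1, so k can moreover be a multiple of
    m - 1; then k + 1 = 1 modulo every prime factor of m - 1, which is the extra
    condition on k. Once k exceeds all the primes used, a divisor found in
    this way is proper.

    What remains is to supply distinct primes, and for this it suffices that the
    order of m modulo the prime attached to a class be the modulus of that
    class, and that the moduli be distinct. For m > 2 and d > 2 a prime modulo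
    which m has order d always exists (a case of the Bang-Zsigmondy theorem,
    [primitive_prime_divisor]): a prime factor of Phi_d(m) that is not of this
    kind must be the largest prime factor q of d and divides Phi_d(m) only once,
    whereas Phi_d(m) >= 2^phi(d) > q. As the modulus 2 has to be avoided (when
    m + 1 is a power of 2 there is no prime of order 2), one uses a covering
    by distinct moduli all greater than 2: the divisors of 120 from 3 on form
    such a system.

    For m = 2 no prime has order 6, and the classical primes 3, 5, 7, 13, 17 and
    241, of orders 2, 4, 3, 12, 8 and 24, are used instead. *)

(** * Multiplicative order modulo a prime *)

Definition has_order p m d := (d.-primitive_root (m%:R : 'F_p))%R.

Lemma Fp_expr_eq1 p m i : prime p ->
  ((m%:R : 'F_p) ^+ i == 1)%R = (m ^ i == 1 %[mod p]).
Proof.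
move=> p_pr; rewrite -natrX -(inj_eq val_inj) [LHS]/= val_Fp_nat //.
by rewrite -(val_Fp_nat p_pr 1).
Qed.

Lemma has_order_dvd p m d i : prime p -> has_order p m d ->
  (d %| i) = (m ^ i == 1 %[mod p]).
Proof. by move=> p_pr ord_d; rewrite (prim_order_dvd ord_d) Fp_expr_eq1. Qed.

Lemma has_order_exists p m n : prime p -> 0 < n -> m ^ n = 1 %[mod p] ->
  {d | has_order p m d & d %| n}.
Proof.
move=> p_pr n_gt0 mn1; apply: prim_order_exists n_gt0 _.
by apply/eqP; rewrite Fp_expr_eq1 //; apply/eqP.
Qed.

Lemma has_order_lt p m d : prime p -> has_order p m d -> 0 < d < p.
Proof.
move=> p_pr ord_d; have d_gt0 := prim_order_gt0 ord_d.
have p_gt1 := prime_gt1 p_pr.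
have co_mp: coprime m p.
  rewrite coprime_sym -(coprime_pexpr p m d_gt0) -coprime_modr.
  have := dvdnn d; rewrite (has_order_dvd _ p_pr ord_d) => /eqP->.
  by rewrite coprime_modr coprimen1.
have: d %| p.-1.
  by rewrite (has_order_dvd _ p_pr ord_d) -totient_prime // Euler_exp_totient.
by move/dvdn_leq; lia.
Qed.

(** * Values of cyclotomic polynomials *)

(** 'X^d - 1 is the product of the 'Phi_e over the divisors e of d, and n is not
    one of them; so 'Phi_n divides the quotient of 'X^n - 1 by 'X^d - 1, which
    is a geometric sum in 'X^d. *)
Lemma Phi_dvd_geom n d m : 1 < m -> 0 < n -> d %| n -> d < n ->
  absz (('Phi_n).[m%:Z])%R %| \sum_(i < n %/ d) (m ^ d) ^ i.
Proof.
move=> m_gt1 n_gt0 dvd_dn ltdn.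
have d_gt0: 0 < d by apply: dvdn_gt0 dvd_dn.
suff [q eq_q]: exists q : {poly int},
    ('X^n - 1 = ('X^d - 1) * ('Phi_n * q) :> {poly int})%R.
  rewrite -[X in _ %| X]/(`|Posz (\sum_(i < n %/ d) (m ^ d) ^ i)|) -dvdzE.
  apply/dvdzP; exists q.[m%:Z]%R.
  have md_neq0: (m%:Z ^+ d - 1 != 0)%R.
    by rewrite subr_eq0 gt_eqF // exprn_egt1 // -lt0n.
  apply: (mulfI md_neq0); rewrite -[LHS]/((_ - 1) * _)%R.
  have ->: (Posz (\sum_(i < n %/ d) (m ^ d) ^ i)%N =
            \sum_(i < n %/ d) (m%:Z ^+ d) ^+ i)%R.
    by rewrite -natz natr_sum; apply: eq_bigr => i _; rewrite !natrX natz.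
  rewrite -subrX1 -exprM mulnC divnK //.
  have /(congr1 (horner^~ m%:Z))%R := eq_q.
  by rewrite !hornerE => ->; rewrite /= mulrAC.
rewrite -!prod_Cyclotomic // (bigID (fun e => e %| d)) /=.
have ->: (\prod_(e <- divisors n | (e %| d)%N) 'Phi_e =
          \prod_(e <- divisors d) 'Phi_e)%R.
  rewrite -big_filter; apply/perm_big/uniq_perm;
    rewrite ?filter_uniq ?divisors_uniq //.
  move=> e; rewrite mem_filter -!dvdn_divisors //.
  by case: (boolP (e %| d)) => //= /dvdn_trans->.
exists (\prod_(e <- divisors n | ~~ (e %| d)%N && (e != n)) 'Phi_e)%R.
congr (_ * _)%R.
rewrite big_mkcond (bigD1_seq n) ?divisors_uniq ?divisors_id //=.
rewrite gtnNdvd // -big_mkcondr; congr (_ * _)%R.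
by apply: eq_bigl => e; rewrite andbC.
Qed.

Lemma geom_sum_mod p y r : y = 1 %[mod p] -> \sum_(i < r) y ^ i = r %[mod p].
Proof.
move=> y1; rewrite -modn_summ (eq_bigr (fun=> 1 %% p)) => [|i _]; last first.
  by rewrite -modnXm y1 modnXm exp1n.
by rewrite modn_summ sum1_card card_ord.
Qed.

(** Modulo p^2 the powers of 1 + p t are the 1 + i p t, and p t is multiplied in
    their sum by the binomial coefficient of p and 2, a multiple of p because p
    is odd. *)
Lemma geom_sum_mod_sqr p y : prime p -> odd p -> y = 1 %[mod p] ->
  \sum_(i < p) y ^ i = p %[mod p ^ 2].
Proof.
move=> p_pr p_odd y1; have p_gt1 := prime_gt1 p_pr.
have [t ->]: exists t, y = 1 + p * t.
  exists (y %/ p); rewrite {1}(divn_eq y p) y1 modn_small //.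
  by rewrite addnC mulnC.
have expE i : (1 + p * t) ^ i = 1 + i * (p * t) %[mod p ^ 2].
  elim: i => [|i IHi]; first by rewrite mul0n.
  rewrite expnS -modnMmr {}IHi modnMmr.
  have ->: (1 + p * t) * (1 + i * (p * t)) =
           i * t * t * p ^ 2 + (1 + i.+1 * (p * t)).
    by rewrite mulnDl !mulnDr mul1n !muln1 mulSn; ring.
  by rewrite modnMDl.
rewrite -modn_summ (eq_bigr (fun i : 'I_p => (1 + i * (p * t)) %% p ^ 2));
  last by move=> i _; apply: expE.
rewrite modn_summ.
rewrite big_split /= sum1_card card_ord -big_distrl /=.
rewrite -(big_mkord predT id) bin2_sum.
have p_gt2: 2 < p by rewrite odd_prime_gt2.
have /dvdnP[c ->]: p %| 'C(p, 2) by rewrite prime_dvd_bin.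
have ->: p + c * p * (p * t) = c * t * p ^ 2 + p by ring.
by rewrite modnMDl.
Qed.

(** Over the complex numbers 'Phi_n(m) is a product of totient n factors m - z
    with z of norm 1, each of norm at least m - 1 >= 2. *)
Lemma leq_Phi_horner n m : 2 < m -> 0 < n ->
  2 ^ totient n <= absz (('Phi_n).[m%:Z])%R.
Proof.
move=> m_gt2 n_gt0; have [z prim_z] := C_prim_root_exists n_gt0.
have card_coprime: #|[pred k : 'I_n | coprime k n]| = totient n.
  rewrite totient_count_coprime big_mkord -sum1_card big_mkcond.
  by apply: eq_bigr => k _; rewrite inE coprime_sym; case: coprime.
rewrite -(ler_nat algC) natr_absz intr_norm natrX.
rewrite -horner_map /= (Cintr_Cyclotomic prim_z) horner_prod normr_prod.
rewrite -card_coprime -prodr_const; apply: ler_prod => k _.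
rewrite ler0n hornerXsubC; apply: le_trans (lerB_dist _ _).
have norm_zk: (`|z ^+ k| = 1)%R.
  rewrite normrX (_ : `|z| = 1)%R ?expr1n //.
  apply/eqP; rewrite -(@pexpr_eq1 _ _ n) ?normr_ge0 // -normrX.
  by rewrite (prim_expr_order prim_z) normr1.
by rewrite norm_zk ger0_norm ?ler0z // lerBrDr natr1 -pmulrn ler_nat.
Qed.

Lemma leq_totient_prime p n : prime p -> 0 < n -> p %| n -> p.-1 <= totient n.
Proof.
move=> p_pr n_gt0 pn; apply: dvdn_leq; first by rewrite totient_gt0.
rewrite totientE // (bigD1_seq p) ?primes_uniq ?mem_primes ?p_pr ?n_gt0 //=.
by rewrite -mulnA dvdn_mulr.
Qed.

Lemma ltn_exp2_totient p n : 2 < n -> prime p -> p %| n -> p < 2 ^ totient n.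
Proof.
move=> n_gt2 p_pr pn; have p_gt1 := prime_gt1 p_pr.
have phi_gt1: 1 < totient n by rewrite totient_gt1.
have := leq_totient_prime p_pr (ltnW (ltnW n_gt2)) pn.
have [->|p_neq2] := eqVneq p 2.
  by move=> _; rewrite (@leq_trans (2 ^ 2)) // leq_exp2l.
move=> le_p_phi; apply: (@leq_trans (2 ^ p.-1)); last by rewrite leq_exp2l.
have: 2 < p by lia.
case: p {p_pr pn p_gt1 p_neq2 le_p_phi} => [|[|[|p]]] //= _.
elim: p => // p IHp; rewrite expnS; lia.
Qed.

(** * Primes modulo which m has a prescribed order *)

(** Let d be the order of m modulo p, a proper divisor of n, and d < p. If d
    still divides n / r for a prime r, then p divides the geometric sum of r
    terms in m^(n/r), all congruent to 1, so p divides r and r = p. Some prime r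
    has this property as d <> n, whence p divides n; every prime factor r >= p
    of n has it too, being coprime to d, whence no prime factor exceeds p;
    taking r = p, the order d divides n / p. *)
Lemma Phi_nonprimitive_factor n m p : 1 < m -> 1 < n -> prime p ->
    p %| absz (('Phi_n).[m%:Z])%R -> ~~ has_order p m n ->
  [/\ p %| n, forall r, prime r -> r %| n -> r <= p
     & m ^ (n %/ p) = 1 %[mod p]].
Proof.
move=> m_gt1 n_gt1 p_pr p_dv_Phi nprim.
have n_gt0 := ltnW n_gt1.
have mn1: m ^ n = 1 %[mod p].
  apply/eqP; rewrite eqn_mod_dvd ?expn_gt0 ?(ltnW m_gt1) // subn1 predn_exp.
  apply/dvdn_mull/(dvdn_trans p_dv_Phi).
  have := Phi_dvd_geom m_gt1 n_gt0 (dvd1n n) n_gt1.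
  by rewrite divn1 expn1.
have [d ord_d dvd_dn] := has_order_exists p_pr n_gt0 mn1.
have /andP[d_gt0 lt_dp] := has_order_lt p_pr ord_d.
have ltdn: d < n.
  rewrite ltn_neqAle dvdn_leq // andbT.
  by apply: contra nprim => /eqP <-.
have r_eq_p r : prime r -> r %| n -> d %| n %/ r -> r = p.
  move=> r_pr r_dv_n d_dv_nr; have r_gt0 := prime_gt0 r_pr.
  have nr_dv_n: n %/ r %| n by rewrite -{2}(divnK r_dv_n) dvdn_mulr.
  have nr_lt_n: n %/ r < n by rewrite ltn_Pdiv // prime_gt1.
  have := dvdn_trans p_dv_Phi (Phi_dvd_geom m_gt1 n_gt0 nr_dv_n nr_lt_n).
  rewrite divnA // mulKn //.
  have /eqP mnr1: m ^ (n %/ r) == 1 %[mod p].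
    by rewrite -(has_order_dvd _ p_pr ord_d).
  by rewrite /dvdn geom_sum_mod // -/(dvdn p r) dvdn_prime2 // => /eqP.
have pn: p %| n.
  have r_pr: prime (pdiv (n %/ d)) by rewrite pdiv_prime // ltn_divRL ?mul1n.
  have r_dv_n: pdiv (n %/ d) %| n.
    by rewrite (dvdn_trans (pdiv_dvd _)) // -{2}(divnK dvd_dn) dvdn_mulr.
  have <- // := r_eq_p _ r_pr r_dv_n.
  by rewrite dvdn_divRL // mulnC -dvdn_divRL // pdiv_dvd.
have d_dv r : prime r -> r %| n -> p <= r -> d %| n %/ r.
  move=> r_pr r_dv_n le_pr.
  have co_dr: coprime d r.
    by rewrite coprime_sym prime_coprime // gtnNdvd // (leq_trans lt_dp).
  by rewrite -(Gauss_dvdl _ co_dr) divnK.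
split=> // [r r_pr r_dv_n|].
  rewrite leqNgt; apply/negP=> lt_pr.
  by have := lt_pr; rewrite (r_eq_p r) ?ltnn ?d_dv // ltnW.
by apply/eqP; rewrite -(has_order_dvd _ p_pr ord_d) d_dv.
Qed.

(** The geometric sum of p terms in y = m^(n/p), a multiple of 'Phi_n(m), is p
    modulo p^2 when p is odd. When p = 2, the number n is a power of 2, so y is
    an odd square and the sum y + 1 is 2 modulo 4. *)
Lemma Phi_nonprimitive_sqr n m p : 1 < m -> 2 < n -> prime p ->
    p %| absz (('Phi_n).[m%:Z])%R -> ~~ has_order p m n ->
  ~~ (p ^ 2 %| absz (('Phi_n).[m%:Z])%R).
Proof.
move=> m_gt1 n_gt2 p_pr p_dv_Phi nprim.
have n_gt1 := ltnW n_gt2; have n_gt0 := ltnW n_gt1.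
have [pn max_p mnp1] := Phi_nonprimitive_factor m_gt1 n_gt1 p_pr p_dv_Phi nprim.
have p_gt0 := prime_gt0 p_pr.
have np_dv_n: n %/ p %| n by rewrite -{2}(divnK pn) dvdn_mulr.
have np_lt_n: n %/ p < n by rewrite ltn_Pdiv // prime_gt1.
have := Phi_dvd_geom m_gt1 n_gt0 np_dv_n np_lt_n.
rewrite divnA // mulKn // => Phi_dv; apply/negP => /dvdn_trans/(_ Phi_dv).
have [p2 | p_odd] := even_prime p_pr; last first.
  rewrite /dvdn geom_sum_mod_sqr // -/(dvdn (p ^ 2) p).
  by move/(dvdn_leq p_gt0); rewrite leqNgt -{1}[p]expn1 ltn_exp2l ?prime_gt1.
move: pn max_p mnp1; rewrite {}p2 => n_even max2 mnp1.
have /dvdnP[h Eh]: 2 %| n %/ 2.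
  have n2_gt1: 1 < n %/ 2 by lia.
  have := max2 _ (pdiv_prime n2_gt1).
  rewrite (dvdn_trans (pdiv_dvd _)); last first.
    by rewrite -{2}(divnK n_even) dvdn_mulr.
  have := prime_gt1 (pdiv_prime n2_gt1) => gt1 /(_ isT) le2.
  have pdiv2: pdiv (n %/ 2) = 2 by apply/eqP; rewrite eqn_leq le2.
  by rewrite -[X in X %| _]pdiv2 pdiv_dvd.
rewrite !big_ord_recr big_ord0 /= expn0 expn1 add0n => dv4.
move: mnp1 dv4; rewrite Eh expnM; set z := m ^ h => z2.
have z_odd: odd z by move: z2; rewrite !modn2 oddX /=; case: (odd z).
(* With z = 1 + 2 w, the sum is 1 + (1 + 2 w)^2, hence 2 modulo 4. *)
rewrite -(odd_double_half z) z_odd -[true + _]/(1 + _).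
have ->: 1 + (1 + (z./2).*2) ^ 2 = (z./2 + z./2 ^ 2) * 4 + 2.
  by rewrite -mul2n; ring.
by rewrite dvdn_addr ?dvdn_mull.
Qed.

(** Otherwise all prime factors of 'Phi_n(m) are equal to the largest prime
    factor p of n. Since 'Phi_n(m) > p, this would make p^2 a divisor. *)
Lemma primitive_prime_divisor n m : 2 < m -> 2 < n ->
  exists2 p, prime p & has_order p m n.
Proof.
move=> m_gt2 n_gt2; have [m_gt1 n_gt1] := (ltnW m_gt2, ltnW n_gt2).
have n_gt0 := ltnW n_gt1.
pose f := absz (('Phi_n).[m%:Z])%R.
have f_ge: 2 ^ totient n <= f := leq_Phi_horner m_gt2 n_gt0.
have f_gt1: 1 < f.
  by rewrite (leq_trans _ f_ge) // (@leq_exp2l 2 1) // totient_gt0.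
have p_pr := pdiv_prime f_gt1; set p := pdiv f in p_pr.
have [ord_p|nprim_p] := boolP (has_order p m n); first by exists p.
have p_dv_f: p %| f := pdiv_dvd f.
have [pn _ _] := Phi_nonprimitive_factor m_gt1 n_gt1 p_pr p_dv_f nprim_p.
(* If p is not primitive, a prime factor q of f / p is used: it is primitive,
   or equal to p, in which case p^2 divides f. *)
have g_gt1: 1 < f %/ p.
  by rewrite ltn_divRL // mul1n (leq_trans _ f_ge) // ltn_exp2_totient.
have q_pr := pdiv_prime g_gt1; set q := pdiv (f %/ p) in q_pr.
have [ord_q|nprim_q] := boolP (has_order q m n); first by exists q.
have pq_dv_f: p * q %| f by rewrite mulnC -dvdn_divRL // pdiv_dvd.
have q_dv_f: q %| f := dvdn_trans (dvdn_mull _ (dvdnn q)) pq_dv_f.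
have [qn max_q _] := Phi_nonprimitive_factor m_gt1 n_gt1 q_pr q_dv_f nprim_q.
have [_ max_p _] := Phi_nonprimitive_factor m_gt1 n_gt1 p_pr p_dv_f nprim_p.
have eq_qp: q = p by apply/eqP; rewrite eqn_leq max_p ?max_q.
have := Phi_nonprimitive_sqr m_gt1 n_gt2 p_pr p_dv_f nprim_p.
by rewrite -mulnn -{2}eq_qp pq_dv_f.
Qed.

(** * Covering systems *)

Lemma crt_seq (I : eqType) (s : seq I) (p r : I -> nat) : uniq s ->
    {in s &, forall i j, i != j -> coprime (p i) (p j)} ->
  exists x, {in s, forall i, x = r i %[mod p i]}.
Proof.
elim: s => [|i s IHs] /=; first by exists 0.
move=> /andP[i_notin_s uniq_s] co_p.
have [|x xP] := IHs uniq_s.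
  by move=> j k js ks; apply: co_p; rewrite inE ?js ?ks orbT.
pose M := \prod_(j <- s) p j.
have co_iM: coprime (p i) M.
  rewrite /M big_seq.
  apply: (big_ind (coprime (p i))) => [|a b|j js]; first exact: coprimen1.
    by rewrite coprimeMr => -> ->.
  by apply: co_p; rewrite ?inE ?eqxx ?js ?orbT //;
    apply: contraNneq i_notin_s => ->.
exists (chinese (p i) M (r i) x) => j; rewrite inE => /predU1P[-> | js].
  exact: chinese_modl.
have pj_dv_M: p j %| M by rewrite /M (big_rem j) //= dvdn_mulr.
by rewrite -(modn_dvdm _ pj_dv_M) chinese_modr // modn_dvdm // xP.
Qed.

(** A pair (d, a) stands for the residue class of a modulo d. *)
Definition covering (s : seq (nat * nat)) :=
  forall n, exists2 c, c \in s & n = c.2 %[mod c.1].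

Lemma covering_period L s : 0 < L ->
    all (fun c => c.1 %| L) s ->
    all (fun n => has (fun c => n == c.2 %[mod c.1]) s) (iota 0 L) ->
  covering s.
Proof.
move=> L_gt0 /allP dvdL /allP cov n.
have /cov/hasP[c cs /eqP nc]: n %% L \in iota 0 L.
  by rewrite mem_iota /= ltn_mod.
by exists c => //; rewrite -nc modn_dvdm // dvdL.
Qed.

(** The conditions on k = (m - 1) x are k m^a = -1 modulo p for every class
    (d, a), where p is the prime of that class; they determine x modulo p
    because (m - 1) m^a is invertible there. The bound M on the primes is their
    product, so all x in a residue class modulo M qualify. *)
Lemma covering_sieve m (s : seq (nat * nat)) (p : nat * nat -> nat) :
    1 < m -> uniq s -> covering s -> {in s &, injective p} ->
    {in s, forall c,
      [/\ 0 < c.1, prime (p c), coprime (p c) m.-1 & m ^ c.1 = 1 %[mod p c]]} ->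
  exists2 M, 0 < M & exists x, forall t n, exists q,
    [/\ prime q, q <= M & q %| m.-1 * (x + t * M) * m ^ n + 1].
Proof.
move=> m_gt1 uniq_s cov inj_p pP; pose M := \prod_(c <- s) p c.
have m1_gt0: 0 < m.-1 by lia.
have M_gt0: 0 < M.
  by rewrite /M big_seq_cond prodn_cond_gt0 // => c /andP[/pP[_ /prime_gt0]].
have co_p c (cs : c \in s) : coprime (p c) (m.-1 * m ^ c.2).
  have [c1_gt0 p_pr co_pm1 mc1] := pP c cs.
  rewrite coprimeMr co_pm1 coprimeXr //=.
  by rewrite -(coprime_pexpr _ _ c1_gt0) -coprime_modr mc1 coprime_modr
    coprimen1.
(* The multiple of (m - 1) m^a that is -1 modulo p, divided by (m - 1) m^a. *)
pose r c := chinese (p c) (m.-1 * m ^ c.2) (p c).-1 0 %/ (m.-1 * m ^ c.2).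
have [|x xP] := @crt_seq _ s p r uniq_s.
  move=> c c' cs c's neq_cc'.
  have [_ p_pr _ _] := pP c cs; have [_ p'_pr _ _] := pP c' c's.
  rewrite prime_coprime // dvdn_prime2 //; apply: contra neq_cc' => /eqP.
  by move/inj_p->.
exists M => //; exists x => t n.
have [c cs nc] := cov n; have [_ p_pr _ mc1] := pP c cs; exists (p c).
have p_dv_M: p c %| M by rewrite /M (big_rem c) //= dvdn_mulr.
split=> //; first exact: dvdn_leq.
have mn: m ^ n = m ^ c.2 %[mod p c].
  have pow e : m ^ e = m ^ (e %% c.1) %[mod p c].
    rewrite {1}(divn_eq e c.1) expnD mulnC [_ * c.1]mulnC expnM.
    by rewrite -modnMmr -modnXm mc1 modnXm exp1n modnMmr muln1.
  by rewrite pow nc -pow.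
have xt: x + t * M = r c %[mod p c].
  by rewrite addnC -modnDml (eqP (dvdn_mull t p_dv_M)) add0n xP.
have u_dv: m.-1 * m ^ c.2 %| chinese (p c) (m.-1 * m ^ c.2) (p c).-1 0.
  by rewrite /dvdn chinese_modr ?mod0n ?co_p.
have E: m.-1 * (x + t * M) * m ^ n = r c * (m.-1 * m ^ c.2) %[mod p c].
  by rewrite -modnMmr mn modnMmr mulnAC -modnMmr xt modnMmr mulnC.
rewrite /dvdn -modnDml E divnK // chinese_modl ?co_p //.
rewrite modnDml addn1 prednK ?prime_gt0 //.
by rewrite modnn.
Qed.

(** * Infinitely many admissible multipliers *)

Lemma injective_infinite_set (f : nat -> int) : injective f ->
  forall A : classical_sets.set int, (forall t, A (f t)) -> infinite_set A.
Proof.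
move=> inj_f A Af finA; apply: infinite_nat.
have := finite_preimage (f := f) (in2W inj_f) finA.
by apply: sub_finite_set => t _; apply: Af.
Qed.

Definition admissible (m : nat) : classical_sets.set int :=
  fun k : int =>
    (forall q : nat, prime q -> (q%:Z %| (m%:Z - 1)%R)%Z ->
       (k <> (- 1)%R %[mod q%:Z])%Z) /\
    (forall n : nat, (0 < n)%N -> composite (k * m%:Z ^+ n + 1)%R).

(** Multiples of m - 1 are never -1 modulo a prime factor of m - 1; and with x
    shifted by a positive multiple of M, the number k m^n + 1 exceeds its prime
    factor, which is at most M. *)
Lemma covering_infinite_admissible m (s : seq (nat * nat))
    (p : nat * nat -> nat) :
    1 < m -> uniq s -> covering s -> {in s &, injective p} ->
    {in s, forall c,
      [/\ 0 < c.1, prime (p c), coprime (p c) m.-1 & m ^ c.1 = 1 %[mod p c]]} ->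
  infinite_set (admissible m).
Proof.
move=> m_gt1 uniq_s cov inj_p pP.
have [M M_gt0 [x xP]] := covering_sieve m_gt1 uniq_s cov inj_p pP.
have m1_gt0: 0 < m.-1 by lia.
have m_gt0 := ltnW m_gt1.
apply: (@injective_infinite_set (fun t => Posz (m.-1 * (x + t.+1 * M)))).
  move=> t u [] /eqP; rewrite eqn_pmul2l // eqn_add2l eqn_pmul2r //.
  by move=> /eqP[].
move=> t; split=> [q q_pr q_dv|n n_gt0].
  have q_dv1 : (q %| m.-1)%N by move: q_dv; rewrite -predn_int.
  move=> /eqP; rewrite eqz_mod_dvd opprK -[1%R]/(Posz 1) -PoszD dvdzE /=.
  rewrite dvdn_addr ?dvdn_mulr // dvdn1 => /eqP q1.
  by rewrite q1 in q_pr.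
have [q [q_pr le_qM q_dv]] := xP t.+1 n.
rewrite -natz -[Posz m]natz -natrX -natrM -[1%R]/(1%:R)%R -natrD natz.
rewrite /composite /=.
have le_M: M <= m.-1 * (x + t.+1 * M) * m ^ n.
  have mn_gt0 : 0 < m ^ n by rewrite expn_gt0 m_gt0.
  rewrite (leq_trans _ (leq_pmulr _ mn_gt0)) //.
  rewrite (leq_trans _ (leq_pmull _ m1_gt0)) //.
  by rewrite mulSn addnCA leq_addr.
apply/andP; split; first by rewrite ltz_nat; lia.
apply/negP=> k_pr; move: q_dv; rewrite dvdn_prime2 // => /eqP; lia.
Qed.

Lemma primitive_prime_family m : 2 < m ->
  exists p : nat -> nat, forall d, 2 < d -> prime (p d) /\ has_order (p d) m d.
Proof.
move=> m_gt2.
(* The guard on d makes the choice of a prime total. *)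
have ex_p d : exists p, (2 < d) ==> prime p && has_order p m d.
  have [d_gt2|d_le2] := ltnP 2 d; last by exists 0.
  have [p p_pr ord_p] := primitive_prime_divisor m_gt2 d_gt2.
  by exists p; rewrite p_pr.
exists (fun d => xchoose (ex_p d)) => d d_gt2.
by have /implyP/(_ d_gt2)/andP := xchooseP (ex_p d).
Qed.

(** A prime determines the order of m modulo it, so distinct moduli get
    distinct primes; and the prime of modulus d > 1 is prime to m - 1, since m
    would otherwise have order 1. *)
Lemma infinite_admissible_gt2 (m : nat) : 2 < m ->
  infinite_set (admissible m).
Proof.
move=> m_gt2; have [p pP] := primitive_prime_family m_gt2.
(* The moduli are the divisors of 120 greater than 2, so the classes need only
   be checked to cover 0, ..., 119. *)
pose s := [:: (3, 0); (4, 0); (5, 0); (6, 1); (8, 2); (10, 1); (12, 5);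
  (15, 2); (20, 3); (24, 22); (30, 29); (40, 6); (60, 14); (120, 38)].
have s_gt2 : {in s, forall c, 2 < c.1} by apply/allP.
have s_inj : {in s &, injective fst}.
  move=> c c' cs c's /eqP; apply: contraTeq => neq.
  have: all (fun c => all (fun c' => (c != c') ==> (c.1 != c'.1)) s) s by [].
  by move=> /allP/(_ c cs)/allP/(_ c' c's); rewrite neq.
apply: (@covering_infinite_admissible m s (p \o fst)) => //; first exact: ltnW.
- by apply: (@covering_period 120).
- move=> c c' cs c's eq_p; apply: s_inj => //.
  have [p_pr ord_p] := pP _ (s_gt2 _ cs); have [_ ord_p'] := pP _ (s_gt2 _ c's).
  move: eq_p ord_p' => /= <- ord_p'.
  by apply/eqP; rewrite eqn_dvd !(prim_order_dvd ord_p, prim_order_dvd ord_p');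
     rewrite !prim_expr_order ?eqxx.
move=> c cs; have c_gt2 := s_gt2 _ cs; have [p_pr ord_p] := pP _ c_gt2.
have c_gt0 : 0 < c.1 := ltnW (ltnW c_gt2).
split=> //=; last by apply/eqP; rewrite -(has_order_dvd _ p_pr ord_p).
rewrite prime_coprime //; apply: contraL c_gt2 => p_dv.
suff : c.1 %| 1 by rewrite dvdn1 => /eqP->.
rewrite (has_order_dvd _ p_pr ord_p) expn1 eqn_mod_dvd ?subn1 ?p_dv //; lia.
Qed.

(** Reducing at each step keeps the unary numbers small enough for powers to be
    evaluated by computation. *)
Lemma expn_iter_mod p m d :
  m ^ d = iter d (fun x => m * x %% p) 1 %[mod p].
Proof.
by elim: d => //= d IHd; rewrite expnS -modnMmr IHd modnMmr modn_mod.
Qed.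

Lemma infinite_admissible_2 : infinite_set (admissible 2).
Proof.
pose s := [:: (2, 0); (3, 0); (4, 1); (8, 3); (12, 7); (24, 23)].
(* The order of 2 modulo each of these primes is the modulus of its class. *)
pose p (c : nat * nat) := nth 0 [:: 3; 7; 5; 17; 13; 241] (index c s).
have uniq_s : uniq s by [].
apply: (@covering_infinite_admissible 2 s p) => //.
- by apply: (@covering_period 24).
- move=> c c' cs c's /eqP; rewrite nth_uniq ?index_mem // => /eqP eq_i.
  by rewrite -(nth_index (0, 0) cs) eq_i nth_index.
have check : all (fun c => [&& 0 < c.1, prime (p c), coprime (p c) 1
    & iter c.1 (fun x => 2 * x %% p c) 1 == 1]) s by vm_compute.
move=> c cs; have /and4P[c_gt0 p_pr co_p1 /eqP pow1] := allP check c cs.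
by split; [ | | | rewrite expn_iter_mod pow1].
Qed.

Local Close Scope nat_scope.
Local Open Scope classical_set_scope.
Local Open Scope ring_scope.

Theorem theorem1 (m : int) (hm : 1 < m) :
  infinite_set [set k : int |
    (forall q : nat, prime q -> (q%:Z %| m - 1)%Z -> (k <> -1 %[mod q%:Z])%Z) /\
    (forall n : nat, (0 < n)%N -> composite (k * m ^+ n + 1))].
Proof.
case: m hm => // m; rewrite ltz_nat leq_eqVlt => /predU1P[<- | m_gt2].
  exact: infinite_admissible_2.
exact: infinite_admissible_gt2.
Qed.
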